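(* For every $2<p<\infty$ there is a Lipschitz map $f\colon\ell_p\to\ell_1$ for which there do not exist a Hilbert space $H$ and Lipschitz maps $g\colon\ell_p\to H$ and $h\colon g(\ell_p)\to\ell_1$ with $f=h\circ g$. More generally, there do not exist a Banach space $Y$ whose modulus of uniform convexity has power type $q$ for some $2\le q<\min\{4,p\}$ and Lipschitz maps $g\colon\ell_p\to Y$, $h\colon g(\ell_p)\to\ell_1$ with $f=h\circ g$.
   Context: A Banach space $(Y,\|\cdot\|)$ has modulus of uniform convexity of power type $q$ if there is $C>0$ such that $\|x+y\|\le2-C\|x-y\|^q$ for all unit vectors $x,y\in Y$. *)

(* Defs.v *)
From HB Require Import structures.
From mathcomp Require Import all_boot all_order all_algebra.
From mathcomp Require Import all_classical all_reals all_analysis.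
Set Implicit Arguments. Unset Strict Implicit. Unset Printing Implicit Defensive.
Import Order.TTheory GRing.Theory Num.Theory.
Import numFieldNormedType.Exports.
Local Open Scope classical_set_scope.
Local Open Scope ring_scope.

Definition in_lp {R : realType} (p : R) (u : nat -> R) : Prop :=
  cvgn (series (fun k => `|u k| `^ p)).

Definition lp_set {R : realType} (p : R) : set (nat -> R) := [set u | in_lp p u].

Definition lp_norm {R : realType} (p : R) (u : nat -> R) : R :=
  (limn (series (fun k => `|u k| `^ p))) `^ p^-1.

Definition seq_sub {R : realType} (u v : nat -> R) : nat -> R := fun k => u k - v k.

Definition lipschitz_lp_lp {R : realType} (p r : R) (f : (nat -> R) -> (nat -> R)) : Prop :=
  (forall x, lp_set p x -> lp_set r (f x)) /\
  exists L : R, forall x y, lp_set p x -> lp_set p y ->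
    lp_norm r (seq_sub (f x) (f y)) <= L * lp_norm p (seq_sub x y).

Definition lipschitz_lp_Y {R : realType} {Y : normedModType R} (p : R)
  (g : (nat -> R) -> Y) : Prop :=
  exists L : R, forall x y, lp_set p x -> lp_set p y ->
    `|g x - g y| <= L * lp_norm p (seq_sub x y).

Definition lipschitz_Y_lp {R : realType} {Y : normedModType R} (A : set Y) (r : R)
  (h : Y -> (nat -> R)) : Prop :=
  (forall y, A y -> lp_set r (h y)) /\
  exists L : R, forall x y, A x -> A y ->
    lp_norm r (seq_sub (h x) (h y)) <= L * `|x - y|.

(* ip is a (real) inner product on Y inducing the norm of Y; a Hilbert space is
   a complete normed space carrying such an inner product. *)
Definition is_inner_product {R : realType} {Y : normedModType R} (ip : Y -> Y -> R) : Prop :=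
  (forall (a : R) (x y z : Y), ip (a *: x + y) z = a * ip x z + ip y z) /\
  (forall x y : Y, ip x y = ip y x) /\
  (forall x : Y, `|x| ^+ 2 = ip x x).

Definition unif_convex_power_type {R : realType} {Y : normedModType R} (q : R) : Prop :=
  exists C : R, 0 < C /\
    forall x y : Y, `|x| = 1 -> `|y| = 1 -> `|x + y| <= 2 - C * `|x - y| `^ q.

(* Main.v *)
Require Import Defs.
From HB Require Import structures.
From mathcomp Require Import all_boot all_order all_algebra.
From mathcomp Require Import all_classical all_reals all_analysis.
From mathcomp Require Import ring lra.
Set Implicit Arguments. Unset Strict Implicit. Unset Printing Implicit Defensive.
Import Order.TTheory GRing.Theory Num.Theory.
Import numFieldNormedType.Exports.
Local Open Scope classical_set_scope.
Local Open Scope ring_scope.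

(** Fix a depth [m] and put [eta = m^(-1/p)]. Think of [x 0] as a time [t] and of
    the other coordinates as transverse directions. Starting from the segment
    [0 <= t <= 1], cut every edge into four equal parts and double the two middle
    ones into a thin diamond of slopes [eta] and [- eta] in a new coordinate.
    After [m] steps the edges still have [l_p]-speed [(1 + m eta^p)^(1/p) <= 2].
    The map [Phi] sends this graph to L_1 of the space of [m] random signs: along
    an edge it moves in the direction of the Riesz product [prod_k (1 + w_k c_k)],
    [c_k] being the slope in the [k]-th coordinate, a nonnegative function of
    mean 1. So it has speed 1, and it still separates the two tips of a diamond of
    duration [tau] by [eta tau / 2]. Off the graph, the corrections of the
    successive scales are cut off on nested conical tubes around the edges. At each
    point at most one scale is not affine in [t] alone, hence there is no loss in
    the Lipschitz constant, although [eta] times the number of scales is large.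

    If this map is factored through [g] with values in a [q]-convex space, then at
    each scale the tips [u], [v] of a diamond are both approximate midpoints of its
    ends, and [g u], [g v] are [c eta tau] apart. Uniform convexity gains a factor
    [1 - c eta^q] in the displacement of [g] along an edge from each scale to the
    next coarser one; in total [(1 - c eta^q)^m], with [m eta^q = m^(1 - q/p)]
    unbounded. The map of the theorem is a direct sum of weighted copies of [Phi],
    with depth [2^(n^2)] and weight [2^-n]. *)

(** * Averages over signs and the diamond map of a fixed depth *)

(* The expectation over [n] random signs: the number [i < 2 ^ n] encodes the signs
   [(-1) ^+ odd i], [(-1) ^+ odd i./2], and so on. *)
Definition avg {R : realType} (n : nat) (F : nat -> R) : R :=
  (\sum_(i < 2 ^ n) F i) / 2 ^+ n.

Lemma sum_double (R : realType) (N : nat) (F : nat -> R) :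
  \sum_(i < N.*2) F i = \sum_(i < N) F i.*2 + \sum_(i < N) F i.*2.+1.
Proof.
elim: N => [|N IH]; first by rewrite !big_ord0 addr0.
by rewrite doubleS !big_ord_recr /= IH; lra.
Qed.

Lemma avgS (R : realType) (n : nat) (F : nat -> R) :
  avg n.+1 F = (avg n (fun i => F i.*2) + avg n (fun i => F i.*2.+1)) / 2.
Proof.
rewrite /avg expnS mul2n sum_double exprS; field.
by rewrite expf_neq0.
Qed.

Lemma le_avg (R : realType) (n : nat) (F G : nat -> R) :
  (forall i, F i <= G i) -> avg n F <= avg n G.
Proof.
by move=> FG; rewrite ler_pM2r ?invr_gt0 ?exprn_gt0//; apply: ler_sum.
Qed.

Lemma eq_avg (R : realType) (n : nat) (F G : nat -> R) :
  F =1 G -> avg n F = avg n G.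
Proof. by move=> FG; congr (_ / _); apply: eq_bigr => i _. Qed.

Lemma avgD (R : realType) (n : nat) (F G : nat -> R) :
  avg n (fun i => F i + G i) = avg n F + avg n G.
Proof. by rewrite /avg big_split mulrDl. Qed.

Lemma avgZ (R : realType) (n : nat) (c : R) (F : nat -> R) :
  avg n (fun i => c * F i) = c * avg n F.
Proof. by rewrite /avg -mulr_sumr mulrA. Qed.

Lemma avg_cst (R : realType) (n : nat) (c : R) : avg n (fun=> c) = c.
Proof.
by rewrite /avg sumr_const card_ord -[c *+ _]mulr_natr natrX mulfK// expf_neq0.
Qed.

(** [eta * tent tau t] is the distance of the two branches of the diamond from its axis: zero on the
    outer quarters, [eta * tau / 4] at the tips [t = tau / 2]. *)
Definition tent {R : realType} (tau t : R) : R :=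
  Num.max 0 (Num.min (t - tau / 4) (3 * tau / 4 - t)).

(* Radius at time [t] of the conical tube around an edge that starts at time [0]
   and has duration [tau]; it is negative at the other times. *)
Definition radius {R : realType} (eta tau t : R) : R :=
  eta / 2 * Num.min t (tau - t).

(* Equal to [eta * tent tau t] on the tubes of the children of the edge. *)
Definition amplitude {R : realType} (eta tau t d : R) : R :=
  Num.max 0 (Num.min (eta * tent tau t) (4 * (radius eta tau t - d))).

Definition clamp {R : realType} (a y : R) : R := Num.max (- a) (Num.min a y).

(** The factor 2 makes [clamp] saturate once [|y|] reaches half the height of the branches; in the
    tubes of the children only the sign of [y] matters. *)
Definition bump {R : realType} (eta tau t d y : R) : R :=
  clamp (amplitude eta tau t d) (2 * y).

Definition segment {R : realType} (tau t : R) : nat :=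
  if t <= tau / 4 then 0%N else if t <= tau / 2 then 1%N
  else if t <= 3 * tau / 4 then 2%N else 3%N.

Definition slope {R : realType} (tau t y : R) : R :=
  let s := if 0 <= y then 1 else -1 in
  match segment tau t with 1%N => s | 2%N => - s | _ => 0 end.

Definition local_time {R : realType} (tau t : R) : R :=
  t - (segment tau t)%:R * (tau / 4).

(** Distance to the nearer branch, in the sup norm of the coordinates used so far. *)
Definition deviation {R : realType} (eta tau t d y : R) : R :=
  Num.max d `| `|y| - eta * tent tau t|.

(* The current edge has duration [tau] and [t] is the time since its start; [d] is
   the transverse distance to the edge in the coordinates already used, and [x]
   lists the unused ones. Outside the tube of the edge [Psi] vanishes. *)
Fixpoint Psi {R : realType} (eta : R) (n : nat) (tau t d : R) (x : nat -> R)
    (i : nat) : R :=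
  if n is n'.+1 then
    (-1) ^+ odd i * bump eta tau t d (x 0%N)
    + (1 + (-1) ^+ odd i * (eta * slope tau t (x 0%N)))
      * Psi eta n' (tau / 4) (local_time tau t) (deviation eta tau t d (x 0%N))
          (fun j => x j.+1) i./2
  else 0.

Definition Phi {R : realType} (eta : R) (n : nat) (tau t d : R) (x : nat -> R)
    (i : nat) : R := t + Psi eta n tau t d x i.

Variant segment_spec {R : realType} (tau t : R) : nat -> R -> R -> Type :=
| Seg0 : t <= tau / 4 -> segment_spec tau t 0%N t 0
| Seg1 : tau / 4 < t <= tau / 2 -> segment_spec tau t 1%N (t - tau / 4) (t - tau / 4)
| Seg2 : tau / 2 < t <= 3 * tau / 4 ->
    segment_spec tau t 2%N (t - tau / 2) (3 * tau / 4 - t)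
| Seg3 : 3 * tau / 4 < t -> segment_spec tau t 3%N (t - 3 * tau / 4) 0.

Lemma segmentP (R : realType) (tau t : R) : 0 < tau ->
  segment_spec tau t (segment tau t) (local_time tau t) (tent tau t).
Proof.
move=> tau0; rewrite /local_time /tent /segment.
case: (leP t (tau / 4)) => [t1|t1].
  have -> : Num.max 0 (Num.min (t - tau / 4) (3 * tau / 4 - t)) = 0.
    by apply/max_idPl; rewrite ge_min; apply/orP; left; lra.
  by rewrite mul0r subr0; constructor.
case: (leP t (tau / 2)) => [t2|t2].
  have -> : Num.max 0 (Num.min (t - tau / 4) (3 * tau / 4 - t)) = t - tau / 4.
    rewrite (_ : Num.min _ _ = t - tau / 4); last by apply/min_idPl; lra.
    by apply/max_idPr; lra.
  by rewrite mul1r; constructor; rewrite t1.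
case: (leP t (3 * tau / 4)) => [t3|t3].
  have -> : Num.max 0 (Num.min (t - tau / 4) (3 * tau / 4 - t)) = 3 * tau / 4 - t.
    rewrite (_ : Num.min _ _ = 3 * tau / 4 - t); last by apply/min_idPr; lra.
    by apply/max_idPr; lra.
  rewrite (_ : t - 2%:R * (tau / 4) = t - tau / 2); last by lra.
  by constructor; rewrite t2.
have -> : Num.max 0 (Num.min (t - tau / 4) (3 * tau / 4 - t)) = 0.
  by apply/max_idPl; rewrite ge_min; apply/orP; right; lra.
rewrite (_ : t - 3%:R * (tau / 4) = t - 3 * tau / 4); last by lra.
by constructor.
Qed.

(** * Lipschitz bounds for the building blocks *)

Lemma normr_clamp (R : realType) (a y : R) : 0 <= a -> `|clamp a y| <= a.
Proof.
move=> a0; rewrite ler_norml /clamp.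
by case: (leP a y) => ?; [case: (leP (- a) a) | case: (leP (- a) y)] => ?; lra.
Qed.

Lemma clamp_lipschitz (R : realType) (a b y z : R) :
  `|clamp a y - clamp b z| <= `|a - b| + `|y - z|.
Proof.
have [] := (ler_norm (a - b), ler_norm (b - a)).
have [] := (ler_norm (y - z), ler_norm (z - y)).
rewrite (distrC b) (distrC z) => h1 h2 h3 h4.
rewrite ler_norml /clamp.
case: (leP a y) => ?; [case: (leP (- a) a) | case: (leP (- a) y)] => ?;
  (case: (leP b z) => ?; [case: (leP (- b) b) | case: (leP (- b) z)] => ?); lra.
Qed.

Lemma amplitude_ge0 (R : realType) (eta tau t d : R) : 0 <= amplitude eta tau t d.
Proof. by rewrite /amplitude le_max lexx. Qed.

Lemma max_lipschitz (R : realType) (a b c d e : R) :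
  `|a - b| <= e -> `|c - d| <= e -> `|Num.max a c - Num.max b d| <= e.
Proof.
rewrite !ler_norml; move=> h1 h2.
by case: (leP a c) => ?; case: (leP b d) => ?; lra.
Qed.

Lemma min_lipschitz (R : realType) (a b c d e : R) :
  `|a - b| <= e -> `|c - d| <= e -> `|Num.min a c - Num.min b d| <= e.
Proof.
rewrite !ler_norml; move=> h1 h2.
by case: (leP a c) => ?; case: (leP b d) => ?; lra.
Qed.

Lemma tent_lipschitz (R : realType) (tau t u : R) :
  `|tent tau t - tent tau u| <= `|t - u|.
Proof.
apply: max_lipschitz; first by rewrite subrr normr0.
apply: min_lipschitz; last rewrite distrC.
all: by rewrite le_eqVlt; apply/orP; left; apply/eqP; congr (`|_|); lra.
Qed.

Lemma radius_lipschitz (R : realType) (eta tau t u : R) : 0 <= eta <= 1 ->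
  `|radius eta tau t - radius eta tau u| <= `|t - u| / 2.
Proof.
move=> /andP[e0 e1]; rewrite /radius -mulrBr normrM.
have h : `|Num.min t (tau - t) - Num.min u (tau - u)| <= `|t - u|.
  apply: min_lipschitz => //; rewrite distrC.
  by rewrite le_eqVlt; apply/orP; left; apply/eqP; congr (`|_|); lra.
rewrite (ger0_norm (_ : 0 <= eta / 2)); last by lra.
rewrite mulrC; apply: ler_pM => //; lra.
Qed.

(** [|y|] and [eta * tent tau t] contribute at most [D] each, and the maximum adds nothing, so the
    bound [2 * D] reproduces itself at the next scale. *)
Lemma deviation_lipschitz (R : realType) (eta tau t d y u e z D : R) :
  0 <= eta <= 1 -> `|t - u| <= D -> `|d - e| <= 2 * D -> `|y - z| <= D ->
  `|deviation eta tau t d y - deviation eta tau u e z| <= 2 * D.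
Proof.
move=> /andP[e0 e1] htu hde hyz; apply: max_lipschitz => //.
apply: le_trans (ler_dist_dist _ _) _.
have h1 : `| `|y| - `|z| | <= D by apply: le_trans hyz; exact: ler_dist_dist.
have h2 : `|eta * (tent tau u - tent tau t)| <= D.
  rewrite normrM ger0_norm//; apply: le_trans htu.
  rewrite -[leRHS]mul1r; apply: ler_pM => //.
  by rewrite (distrC t); exact: tent_lipschitz.
rewrite (_ : _ - _ = (`|y| - `|z|) + eta * (tent tau u - tent tau t)); last by lra.
by apply: le_trans (ler_normD _ _) _; lra.
Qed.

(** The constant is 2 from [2 * y] plus 10 = 4 (1/2 + 2) from the cut-off in [amplitude]. *)
Lemma bump_lipschitz (R : realType) (eta tau t d y u e z D : R) :
  0 <= eta <= 1 -> `|t - u| <= D -> `|d - e| <= 2 * D -> `|y - z| <= D ->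
  `|bump eta tau t d y - bump eta tau u e z| <= 12 * D.
Proof.
move=> e01 htu hde hyz; apply: le_trans (clamp_lipschitz _ _ _ _) _.
have h1 : `|2 * y - 2 * z| <= 2 * D.
  by rewrite -mulrBr normrM ger0_norm// ler_pM2l.
suff : `|amplitude eta tau t d - amplitude eta tau u e| <= 10 * D by lra.
have D0 : 0 <= D by apply: le_trans htu.
apply: max_lipschitz; first by rewrite subrr normr0; lra.
apply: min_lipschitz.
  have /andP[e0 e1] := e01.
  rewrite -mulrBr normrM ger0_norm// (@le_trans _ _ D) //; last by lra.
  rewrite -[leRHS]mul1r; apply: ler_pM => //.
  by apply: le_trans htu; exact: tent_lipschitz.
have h2 := radius_lipschitz tau t u e01.
rewrite -mulrBr normrM ger0_norm//.
rewrite (_ : 10 * D = 4 * (D / 2 + 2 * D)); last by lra.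
rewrite ler_pM2l//.
rewrite (_ : _ - _ = (radius eta tau t - radius eta tau u) + (e - d)); last by lra.
apply: le_trans (ler_normD _ _) _; rewrite (distrC e); lra.
Qed.

(** * Mean-one weights, size and support of the corrections *)

Lemma avg_weighted (R : realType) (n : nat) (c : R) (F : nat -> R) :
  avg n.+1 (fun i => (1 + (-1) ^+ odd i * c) * F i./2) = avg n F.
Proof.
rewrite avgS (@eq_avg _ _ _ (fun i => (1 + c) * F i)); last first.
  by move=> i /=; rewrite odd_double doubleK expr0 mul1r.
rewrite [X in _ + X](@eq_avg _ _ _ (fun i => (1 - c) * F i)); last first.
  by move=> i /=; rewrite uphalf_double odd_double expr1 mulN1r.
by rewrite !avgZ; lra.
Qed.

Lemma signed_weight_ge0 (R : realType) (i : nat) (c : R) : `|c| <= 1 ->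
  0 <= 1 + (-1) ^+ odd i * c.
Proof. by rewrite ler_norml; case: (odd i); rewrite ?expr1 ?expr0; lra. Qed.

(** The weight is nonnegative and has mean 1 over the lowest sign, on which [F i./2] does not
    depend. So passing to a child edge preserves L_1 norms exactly. *)
Lemma avg_norm_weighted (R : realType) (n : nat) (c : R) (F : nat -> R) :
  `|c| <= 1 ->
  avg n.+1 (fun i => `|(1 + (-1) ^+ odd i * c) * F i./2|) = avg n (fun i => `|F i|).
Proof.
move=> c1; rewrite -(avg_weighted n c); apply: eq_avg => i.
by rewrite normrM ger0_norm// signed_weight_ge0.
Qed.

Lemma slope_norm (R : realType) (eta tau t y : R) : 0 <= eta <= 1 ->
  `|eta * slope tau t y| <= 1.
Proof.
move=> /andP[e0 e1]; rewrite normrM ger0_norm// -[leRHS]mulr1.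
apply: ler_pM => //; rewrite /slope.
by case: segment => [|[|[|?]]]; case: (leP 0 y); rewrite ?normrN ?normr0 ?normr1.
Qed.

(** On the outer quarters there is no bump and the tube does not widen. On the middle ones its
    radius at least halves and is at most half the height of the branch. *)
Lemma localP (R : realType) (tau t : R) : 0 < tau ->
  (tent tau t = 0 /\ (forall y, slope tau t y = 0) /\
   Num.min (local_time tau t) (tau / 4 - local_time tau t) <= Num.min t (tau - t)) \/
  (0 <= tent tau t /\ tent tau t <= Num.min t (tau - t) /\
   Num.min (local_time tau t) (tau / 4 - local_time tau t)
     <= Num.min t (tau - t) / 2 /\
   Num.min (local_time tau t) (tau / 4 - local_time tau t) <= tent tau t).
Proof.
move=> tau0; rewrite /slope; case: (segmentP t tau0) => ht.
- left; split=> //; split=> //; rewrite le_min !ge_min; lra.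
- right; split; first lra; split; first by rewrite le_min; lra.
  split; last by rewrite ge_min; lra.
  rewrite ge_min; case: (leP t (tau - t)) => ?; lra.
- right; split; first lra; split; first by rewrite le_min; lra.
  split; last by rewrite ge_min; lra.
  rewrite ge_min; case: (leP t (tau - t)) => ?; lra.
- left; split=> //; split=> //; rewrite le_min !ge_min; lra.
Qed.

Lemma le_max0 (R : realType) (a b : R) : a <= b -> Num.max 0 a <= Num.max 0 b.
Proof. by move=> ab; rewrite ge_max !le_max lexx ab orbT. Qed.

Lemma normr_bump (R : realType) (eta tau t d y : R) : 
  `|bump eta tau t d y| <= 4 * Num.max 0 (radius eta tau t - d).
Proof.
apply: le_trans (normr_clamp _ (amplitude_ge0 _ _ _ _)) _.
rewrite [leRHS]maxr_pMr// mulr0; apply: le_max0.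
by rewrite ge_min lexx orbT.
Qed.

Lemma bump_tent0 (R : realType) (eta tau t d y : R) :
  tent tau t = 0 -> bump eta tau t d y = 0.
Proof.
move=> t0; suff a0 : amplitude eta tau t d = 0.
  apply/eqP; rewrite -normr_le0 -a0; apply: normr_clamp; exact: amplitude_ge0.
rewrite /amplitude t0 mulr0; apply/max_idPl.
by rewrite ge_min lexx.
Qed.

(** Induction on the scales. Where [bump] is nonzero it costs at most 4 times the distance
    [radius - d] to the wall of the tube, and that distance at least halves in the child: 4 + 10/2
    <= 10. *)
Lemma Psi_bound (R : realType) (eta : R) (n : nat) (tau t d : R) (x : nat -> R) :
  0 <= eta <= 1 -> 0 < tau -> 0 <= d ->
  avg n (fun i => `|Psi eta n tau t d x i|) <= 10 * Num.max 0 (radius eta tau t - d).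
Proof.
move=> e01; have /andP[e0 e1] := e01.
elim: n tau t d x => [|n IH] tau t d x tau0 d0.
  rewrite (@eq_avg _ _ _ (fun=> 0)) ?avg_cst; last by move=> i /=; rewrite normr0.
  by rewrite mulr_ge0// le_max lexx.
set h := bump eta tau t d (x 0%N).
set c := eta * slope tau t (x 0%N).
set d' := deviation eta tau t d (x 0%N).
set t' := local_time tau t.
have dd' : d <= d' by rewrite le_max lexx.
have := IH (tau / 4) t' d' (fun j => x j.+1).
rewrite divr_gt0// (le_trans d0 dd') => /(_ isT isT).
set P := Psi _ n _ _ _ _; set r' := radius eta (tau / 4) t' => IHP.
have step : avg n.+1 (fun i => `|Psi eta n.+1 tau t d x i|)
    <= `|h| + 10 * Num.max 0 (r' - d').
  apply: (@le_trans _ _ (`|h| + avg n (fun i => `|P i|))); last by rewrite lerD2l.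
  rewrite -(avg_norm_weighted n P (slope_norm tau t (x 0%N) e01)) -/c.
  rewrite -(avg_cst n.+1 `|h|) -avgD; apply: le_avg => i /=.
  apply: le_trans (ler_normD _ _) _; rewrite lerD2r normrM.
  by rewrite normr_sign mul1r.
apply: le_trans step _.
case: (localP t tau0) => [[tt0 [_ mm]]|[tt0 [ttm [mm mt]]]].
  rewrite /h bump_tent0// normr0 add0r ler_pM2l//; apply: le_max0.
  have : r' <= radius eta tau t by rewrite /r' /radius ler_wpM2l// divr_ge0.
  lra.
have hr : r' <= radius eta tau t / 2.
  by rewrite /r' /radius -[leRHS]mulrA ler_wpM2l// divr_ge0.
have := normr_bump eta tau t d (x 0%N); rewrite -/h.
case: (leP 0 (r' - d')) => ?; case: (leP 0 (radius eta tau t - d)) => ?; lra.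
Qed.

(** The tubes are nested: from an edge to its child the radius does not grow and the deviation does
    not shrink. *)
Lemma Psi_eq0 (R : realType) (eta : R) (n : nat) (tau t d : R) (x : nat -> R) (i : nat) :
  0 <= eta <= 1 -> 0 < tau -> 0 <= d -> radius eta tau t <= d ->
  Psi eta n tau t d x i = 0.
Proof.
move=> e01; have /andP[e0 e1] := e01.
elim: n tau t d x i => [//|n IH] tau t d x i tau0 d0 rd /=.
have dd' : d <= deviation eta tau t d (x 0%N) by rewrite le_max lexx.
have -> : bump eta tau t d (x 0%N) = 0.
  apply/eqP; rewrite -normr_le0; apply: le_trans (normr_bump _ _ _ _ _) _.
  by rewrite (_ : Num.max 0 _ = 0) ?mulr0//; apply/max_idPl; lra.
rewrite IH ?mulr0 ?addr0//; [by rewrite divr_gt0|exact: le_trans dd'|].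
apply: le_trans dd'; apply: le_trans rd; rewrite /radius ler_wpM2l ?divr_ge0//.
case: (localP t tau0) => [[_ [_ //]]|[tt0 [ttm [mm mt]]]].
by apply: le_trans mm _; have := le_trans tt0 ttm; lra.
Qed.

(** In the tube of a child neither cut-off acts: [d] is at most half the radius, so the conical
    bound exceeds [eta * tent tau t], and [|y|] is at least half of [eta * tent tau t]. *)
Lemma bump_near_tent (R : realType) (eta tau t d y : R) :
  0 <= eta <= 1 -> 0 < tau ->
  deviation eta tau t d y <= radius eta (tau / 4) (local_time tau t) ->
  bump eta tau t d y = (if 0 <= y then 1 else -1) * (eta * tent tau t).
Proof.
move=> e01 tau0; have /andP[e0 e1] := e01.
case: (localP t tau0) => [[tt0 _]|[tt0 [ttm [mm mt]]]].
  by move=> _; rewrite bump_tent0// tt0 !mulr0.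
rewrite /deviation ge_max => /andP[dr yr].
have amp : amplitude eta tau t d = eta * tent tau t.
  have h1 : radius eta (tau / 4) (local_time tau t) <= radius eta tau t / 2.
    by rewrite /radius -[leRHS]mulrA ler_wpM2l// divr_ge0.
  have h2 : eta * tent tau t <= 2 * radius eta tau t.
    rewrite /radius mulrA (_ : 2 * (eta / 2) = eta); last by lra.
    by rewrite ler_wpM2l.
  have h3 := mulr_ge0 e0 tt0.
  rewrite /amplitude (_ : Num.min _ _ = eta * tent tau t); first exact/max_idPr.
  by apply/min_idPl; lra.
have yt : eta * tent tau t <= 2 * `|y|.
  have h1 : radius eta (tau / 4) (local_time tau t) <= eta / 2 * tent tau t.
    by rewrite /radius ler_wpM2l// divr_ge0.
  have := le_trans yr h1; rewrite ler_norml; lra.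
have st := mulr_ge0 e0 tt0.
rewrite /bump amp /clamp; move: yt; case: (leP 0 y) => y0.
  rewrite ger0_norm// => yt; rewrite (_ : Num.min _ _ = eta * tent tau t).
    by rewrite mul1r; apply/max_idPr; lra.
  by apply/min_idPl.
rewrite ltr0_norm// => yt; rewrite (_ : Num.min _ _ = 2 * y).
  by rewrite mulN1r; apply/max_idPl; lra.
by apply/min_idPr; lra.
Qed.

(** Hence the bump is affine in time there; on the third quarter the edge starts at a tip, whence
    the shift by [tau / 4]. *)
Lemma bump_tube (R : realType) (eta tau t d y : R) :
  0 <= eta <= 1 -> 0 < tau ->
  deviation eta tau t d y <= radius eta (tau / 4) (local_time tau t) ->
  bump eta tau t d y
  = eta * slope tau t y * (local_time tau t - (segment tau t == 2%N)%:R * (tau / 4)).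
Proof.
move=> e01 tau0 h; rewrite bump_near_tent// /slope.
by case: (segmentP t tau0) => ht /=; case: (0 <= y); lra.
Qed.

(** Points not on the same child edge are near the wall of the tube or outside it. Either an end of
    the edge lies between the two times, and the radius is small there, or [y] and [z] have opposite
    signs, so that [|y| <= D] is too close to the axis. *)
Lemma tube_separation (R : realType) (eta tau t d y u z D : R) :
  0 <= eta <= 1 -> 0 < tau -> 0 <= d -> `|t - u| <= D -> `|y - z| <= D ->
  (segment tau t != segment tau u) || (slope tau t y != slope tau u z) ->
  radius eta (tau / 4) (local_time tau t) - deviation eta tau t d y <= D.
Proof.
move=> e01 tau0 d0 tu yz; have /andP[e0 e1] := e01.
have D0 : 0 <= D by apply: le_trans tu.
have d'0 : 0 <= deviation eta tau t d y by rewrite le_max d0.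
have eD : eta / 2 * D <= D.
  by rewrite -[leRHS]mul1r ler_wpM2r//; lra.
case: eqVneq => [tu_seg|tu_seg] /=; last first.
  move=> _; suff : radius eta (tau / 4) (local_time tau t) <= eta / 2 * D by lra.
  rewrite /radius ler_wpM2l//; first lra.
  rewrite ge_min; move: tu_seg tu; rewrite ler_norml.
  by case: (segmentP t tau0) => ht; case: (segmentP u tau0) => hu // _ tu; lra.
move=> sl.
have [tt0 mt ss] : [/\ 0 <= tent tau t,
    Num.min (local_time tau t) (tau / 4 - local_time tau t) <= tent tau t
  & (0 <= y) != (0 <= z)].
  case: (localP t tau0) => [[tt0 [st _]]|[tt0 [ttm [mm mt]]]].
    move: sl (st y); rewrite /slope tu_seg.
    case: (segment tau u) => [|[|[|?]]]; rewrite ?eqxx//; case: (0 <= y); lra.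
  split=> //; move: sl; apply: contra => /eqP yz0.
  by rewrite /slope tu_seg yz0.
have ry : `|y| <= D.
  move: ss yz; rewrite !ler_norml.
  by case: (leP 0 y) => ?; case: (leP 0 z) => ? // _; lra.
have h1 : radius eta (tau / 4) (local_time tau t) <= eta / 2 * tent tau t.
  by rewrite /radius ler_wpM2l// divr_ge0.
have h2 := mulr_ge0 e0 tt0.
have h3 : `| `|y| - eta * tent tau t| <= deviation eta tau t d y.
  by rewrite le_max lexx orbT.
have := le_trans (ler_norm (- (`|y| - eta * tent tau t))) (le_trans _ h3).
rewrite normrN lexx => /(_ isT); lra.
Qed.

(* The hypothesis on [d] and [e] is inherited by [deviation], since the edges move
   transversally with speed [eta <= 1]; so the constant does not grow with [n]. *)
Lemma Phi_lipschitz (R : realType) (eta : R) (n : nat) (tau t d u e D : R)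
    (x z : nat -> R) :
  0 <= eta <= 1 -> 0 < tau -> 0 <= d -> 0 <= e ->
  `|t - u| <= D -> `|d - e| <= 2 * D -> (forall j, `|x j - z j| <= D) ->
  avg n (fun i => `|Phi eta n tau t d x i - Phi eta n tau u e z i|) <= 80 * D.
Proof.
move=> e01; have /andP[e0 e1] := e01.
elim: n tau t d u e x z => [|n IH] tau t d u e x z tau0 d0 e0' tu de xz.
  rewrite (@eq_avg _ _ _ (fun=> `|t - u|)) ?avg_cst.
    by have := le_trans (normr_ge0 _) tu; lra.
  by move=> i /=; rewrite /Phi /= !addr0.
have D0 : 0 <= D by apply: le_trans tu.
set h := bump eta tau t d (x 0%N); set k := bump eta tau u e (z 0%N).
have hk : `|h - k| <= 12 * D := bump_lipschitz tau e01 tu de (xz 0%N).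
set d' := deviation eta tau t d (x 0%N); set e' := deviation eta tau u e (z 0%N).
have de' : `|d' - e'| <= 2 * D := deviation_lipschitz tau e01 tu de (xz 0%N).
have d'0 : 0 <= d' by rewrite le_max d0.
have e'0 : 0 <= e' by rewrite le_max e0'.
have tau4 : 0 < tau / 4 by rewrite divr_gt0.
set rt := radius eta (tau / 4) (local_time tau t).
set ru := radius eta (tau / 4) (local_time tau u).
set P := Psi eta n (tau / 4) (local_time tau t) d' (fun j => x j.+1).
set Q := Psi eta n (tau / 4) (local_time tau u) e' (fun j => z j.+1).
have hP : avg n (fun i => `|P i|) <= 10 * Num.max 0 (rt - d').
  exact: Psi_bound.
have hQ : avg n (fun i => `|Q i|) <= 10 * Num.max 0 (ru - e').
  exact: Psi_bound.
have far : rt - d' <= 3 * D -> ru - e' <= 3 * D ->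
    avg n.+1 (fun i => `|Phi eta n.+1 tau t d x i - Phi eta n.+1 tau u e z i|)
    <= 80 * D.
  move=> hrt hru.
  have {}hP : avg n (fun i => `|P i|) <= 30 * D.
    by move: hP; case: (leP 0 (rt - d')) => ?; lra.
  have {}hQ : avg n (fun i => `|Q i|) <= 30 * D.
    by move: hQ; case: (leP 0 (ru - e')) => ?; lra.
  rewrite -(avg_norm_weighted n P (slope_norm tau t (x 0%N) e01)) in hP.
  rewrite -(avg_norm_weighted n Q (slope_norm tau u (z 0%N) e01)) in hQ.
  apply: (@le_trans _ _ (13 * D + 30 * D + 30 * D)); last by lra.
  apply: le_trans (lerD (lerD (lexx _) hP) hQ).
  rewrite -(avg_cst n.+1 (13 * D)) -!avgD; apply: le_avg => i.
  rewrite /Phi /= -/h -/k -/d' -/e' -/P -/Q.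
  set a := _ * P _; set b := _ * Q _.
  rewrite (_ : _ - _ = (t - u) + (-1) ^+ odd i * (h - k) + a - b); last by ring.
  apply: le_trans (ler_normB _ _) _; rewrite lerD2r.
  apply: le_trans (ler_normD _ _) _; rewrite lerD2r.
  apply: le_trans (ler_normD _ _) _; rewrite normrM normr_sign; lra.
have := @tube_separation _ eta tau t d (x 0%N) u (z 0%N) D e01 tau0 d0 tu (xz 0%N).
have := @tube_separation _ eta tau u e (z 0%N) t (x 0%N) D e01 tau0 e0'.
rewrite (distrC u) (distrC (z 0%N)) tu (xz 0%N) => /(_ isT isT).
rewrite ![segment tau u == _]eq_sym ![slope tau u _ == _]eq_sym -/d' -/e' -/rt -/ru.
case: eqVneq => [seg|_] /=; last by move=> /(_ isT) ? /(_ isT) ?; apply: far; lra.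
case: eqVneq => [slo|_] /=; last by move=> /(_ isT) ? /(_ isT) ?; apply: far; lra.
move=> _ _.
have tul : local_time tau t - local_time tau u = t - u.
  by rewrite /local_time seg; ring.
have rtu : `|rt - ru| <= D.
  apply: le_trans (radius_lipschitz _ _ _ e01) _; rewrite tul; lra.
move: rtu de'; rewrite !ler_norml => rtu de'.
case: (leP d' rt) => hd; last by apply: far; lra.
case: (leP e' ru) => he; last by apply: far; lra.
set c := eta * slope tau t (x 0%N).
(* Both points are in the tube of the same child: the difference of [Phi] is then the weight times
   the difference one scale down, and the constant 80 is inherited without loss. *)
have hkE : h - k = c * (t - u).
  by rewrite /h /k !bump_tube// -slo seg -/c -tul; ring.
pose F i := Phi eta n (tau / 4) (local_time tau t) d' (fun j => x j.+1) i -
  Phi eta n (tau / 4) (local_time tau u) e' (fun j => z j.+1) i.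
rewrite (@eq_avg _ _ _ (fun i => `|(1 + (-1) ^+ odd i * c) * F i./2|)).
  rewrite avg_norm_weighted ?slope_norm//; apply: IH => //.
  - by rewrite tul.
  - by rewrite ler_norml.
move=> i; congr (`|_|).
rewrite /F /Phi /= -/h -/k -/d' -/e' -/P -/Q -slo -/c.
rewrite (_ : t + _ - _ = (t - u) + (-1) ^+ odd i * (h - k)
  + (1 + (-1) ^+ odd i * c) * (P i./2 - Q i./2)); last by ring.
rewrite hkE -tul; ring.
Qed.

(** * Self-similarity along the edges of the graph *)

Lemma local_time_itv (R : realType) (tau t : R) : 0 < tau -> 0 <= t <= tau ->
  0 <= local_time tau t <= tau / 4.
Proof. by move=> tau0; case: (segmentP t tau0) => ht; lra. Qed.

Lemma tent_child (R : realType) (tau s : R) (c : nat) :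
  0 < tau -> (c < 4)%N -> 0 <= s <= tau / 4 ->
  tent tau (c%:R * (tau / 4) + s)
  = if c == 1%N then s else if c == 2%N then tau / 4 - s else 0.
Proof.
move=> tau0; case: c => [|[|[|[|//]]]] _ hs /=;
  case: (segmentP _ tau0) => ht; lra.
Qed.

Definition child {R : realType} (eta tau sg : R) (c : nat) (s : R) (x : nat -> R)
    (j : nat) : R :=
  if j is j'.+1 then x j' else sg * (eta * tent tau (c%:R * (tau / 4) + s)).

Definition child_slope {R : realType} (sg : R) (c : nat) : R :=
  if c == 1%N then sg else if c == 2%N then - sg else 0.

Lemma radius_ge0 (R : realType) (eta tau t : R) : 0 <= eta -> 0 <= t <= tau ->
  0 <= radius eta tau t.
Proof.
by move=> e0 ht; rewrite mulr_ge0 ?divr_ge0// le_min; lra.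
Qed.

Lemma bump_child (R : realType) (eta tau sg s : R) (c : nat) (x : nat -> R) :
  0 <= eta <= 1 -> 0 < tau -> (c < 4)%N -> 0 <= s <= tau / 4 -> `|sg| = 1 ->
  let t := c%:R * (tau / 4) + s in
  deviation eta tau t 0 (child eta tau sg c s x 0%N) = 0 /\
  bump eta tau t 0 (child eta tau sg c s x 0%N) = sg * (eta * tent tau t).
Proof.
move=> e01 tau0 c4 hs sg1 t; have /andP[e0 e1] := e01.
have ht : 0 <= t <= tau.
  rewrite /t; case: c c4 @t => [|[|[|[|//]]]] _ /=; rewrite ?mul0r; lra.
have tt0 : 0 <= eta * tent tau t by rewrite mulr_ge0// le_max lexx.
have dev0 : deviation eta tau t 0 (child eta tau sg c s x 0%N) = 0.
  rewrite /deviation /child -/t normrM sg1 mul1r (ger0_norm tt0) subrr normr0.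
  by rewrite maxxx.
split=> //; rewrite bump_near_tent// ?dev0; last first.
  by rewrite radius_ge0// local_time_itv.
move: sg1; rewrite /child -/t; case: (leP 0 sg) => sg0.
  by rewrite ger0_norm// => ->; rewrite mul1r tt0 mul1r.
rewrite ltr0_norm// => sg1; have -> : sg = -1 by lra.
rewrite mulN1r oppr_ge0; case: (leP (eta * _) 0) => h; last by rewrite mulN1r.
by rewrite (_ : eta * tent tau t = 0) ?mulr0 ?oppr0//; lra.
Qed.

Lemma Phi_child (R : realType) (eta tau sg s : R) (n c i : nat) (x : nat -> R) :
  0 < eta <= 1 -> 0 < tau -> (c < 4)%N -> 0 <= s <= tau / 4 -> `|sg| = 1 ->
  Phi eta n.+1 tau (c%:R * (tau / 4) + s) 0 (child eta tau sg c s x) i =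
  c%:R * (tau / 4) + (-1) ^+ odd i * (sg * eta * (c == 2%N)%:R * (tau / 4)) +
  (1 + (-1) ^+ odd i * (eta * child_slope sg c)) * Phi eta n (tau / 4) s 0 x i./2.
Proof.
move=> /andP[e0 e1] tau0 c4 hs sg1.
have e01 : 0 <= eta <= 1 by rewrite ltW.
have [dev0 bmp] := bump_child x e01 tau0 c4 hs sg1.
have tau4 : 0 < tau / 4 by rewrite divr_gt0.
rewrite /Phi /= {}dev0 {}bmp tent_child//.
set t := c%:R * (tau / 4) + s.
have bE : sg * (eta * (if c == 1%N then s else if c == 2%N then tau / 4 - s else 0))
   = sg * eta * (c == 2%N)%:R * (tau / 4) + eta * child_slope sg c * s.
  by rewrite /child_slope; move: c4 {t}; case: c => [|[|[|[|//]]]] _ /=; ring.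
(* At a common end of two edges [segment] may pick the neighbouring edge; the radius is zero there,
   so both [Psi] terms vanish. *)
have [s_int|s_bd] := boolP (0 < s < tau / 4); last first.
  have sE : s = 0 \/ s = tau / 4.
    by move: s_bd; rewrite negb_and -!leNgt => /orP[?|?]; [left|right]; lra.
  have lt0 : local_time tau t = 0 \/ local_time tau t = tau / 4.
    rewrite /t; move: c4 {t bE}; case: c => [|[|[|[|//]]]] _ /=; case: sE => ->;
    case: (segmentP _ tau0) => ht; (lra || (left; lra) || (right; lra)).
  have r0 (r : R) : r = 0 \/ r = tau / 4 -> radius eta (tau / 4) r <= 0.
    move=> rE; rewrite /radius (_ : Num.min _ _ = 0) ?mulr0//.
    case: rE => ->; rewrite ?subr0 ?subrr.
      by apply/min_idPl; lra.
    by apply/min_idPr; lra.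
  rewrite !Psi_eq0//; [|exact: r0|exact: r0].
  rewrite bE; by rewrite /t; ring.
have [segE ltE] : segment tau t = c /\ local_time tau t = s.
  rewrite /t; move: c4 {t bE}; case: c => [|[|[|[|//]]]] _ /=;
    case: (segmentP _ tau0) => ht; first [by exfalso; lra | by split=> //; lra].
have slE : slope tau t (child eta tau sg c s x 0%N) = child_slope sg c.
  rewrite /slope /child_slope segE /child tent_child//; move: c4 => _.
  have h (r : R) : 0 < r -> (if 0 <= sg * (eta * r) then 1 else -1) = sg.
    by move=> r0; rewrite pmulr_lge0 ?mulr_gt0//; move: sg1; case: (leP 0 sg) => sg0;
      [rewrite ger0_norm//|rewrite ltr0_norm//]; lra.
  case: c {bE t segE ltE} => [|[|[|c]]] //=; rewrite h//; lra.
rewrite /child tent_child// -/t in slE.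
rewrite slE ltE bE /t; ring.
Qed.

(** * Loss of displacement in uniformly convex targets *)

Lemma normalize_dist (R : realType) (Y : normedModType R) (x : Y) (d : R) :
  0 < `|x| -> `|x| <= 1 -> 1 - d <= `|x| ->
  `| `|x|^-1 *: x| = 1 /\ `| `|x|^-1 *: x - x| <= d.
Proof.
move=> x0 x1 xd; have xn0 : `|x| != 0 by rewrite gt_eqF.
split; first by rewrite normrZ normfV normr_id mulVf.
rewrite -[X in _ - X]scale1r -scalerBl normrZ ger0_norm.
  by rewrite mulrBl mulVf// mul1r; lra.
by rewrite subr_ge0 -invr1 lef_pV2// posrE.
Qed.

(** After scaling to [rho = 1], a sum of norm close to 2 forces both norms close to 1, so
    normalizing moves the vectors little and the condition on the sphere applies. *)
Lemma unif_convex_ball (R : realType) (Y : normedModType R) (q : R) :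
  1 <= q -> unif_convex_power_type (Y := Y) q ->
  exists C : R, [/\ 0 < C, C <= 1 &
    forall (theta rho : R) (a b : Y), 0 <= theta <= 1 -> 0 <= rho ->
      `|a| <= rho -> `|b| <= rho -> theta * rho <= `|a - b| ->
      `|a + b| <= 2 * rho * (1 - C * theta `^ q)].
Proof.
move=> q1 [C [C0 uc]].
(* The bound 1/16 keeps the normalized vectors [theta / 2] apart; the 6 covers three deficits [d],
   each below [2 * C' * theta ^ q]. *)
pose C' := Num.min (1 / 16) (C * (2^-1 `^ q) / 6).
have hq : 0 < (2^-1 : R) `^ q by rewrite powR_gt0.
have C'0 : 0 < C' by rewrite lt_min divr_gt0//= divr_gt0// mulr_gt0.
have C'1 : C' <= 1 / 16 by rewrite ge_min lexx.
have C'2 : 6 * C' <= C * 2^-1 `^ q.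
  rewrite mulrC -ler_pdivlMr//; by rewrite ge_min lexx orbT.
exists C'; split=> //; first lra.
move=> e rho a b /andP[e0 e1] rho0 ha hb hab.
case: (ltgtP rho 0) rho0 => // [rho0 _|rho0 _]; last first.
  rewrite rho0 mulr0 mul0r; apply: le_trans (ler_normD _ _) _; lra.
have [x xE] : exists x, a = rho *: x.
  by exists (rho^-1 *: a); rewrite scalerA divff ?scale1r// gt_eqF.
have [y yE] : exists y, b = rho *: y.
  by exists (rho^-1 *: b); rewrite scalerA divff ?scale1r// gt_eqF.
have nz (z : Y) : `|rho *: z| = rho * `|z| by rewrite normrZ gtr0_norm.
move: ha hb hab; rewrite {a}xE {b}yE -scalerBr -scalerDr !nz (mulrC e) ler_pM2l//.
rewrite -[X in _ <= X -> _ <= X -> _]mulr1 !ler_pM2l// => x1 y1 xye.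
rewrite (mulrC 2) -mulrA ler_pM2l// leNgt; apply/negP => hd.
case: (ltgtP e 0) e0 => // [e0 _|e0 _]; last first.
  move: hd; rewrite e0 powR0; last by rewrite gt_eqF//; lra.
  by have := ler_normD x y; lra.
have eq_e : e `^ q <= e by apply: ge1r_powR => //; rewrite e0.
have eq0 : 0 < e `^ q by rewrite powR_gt0.
pose d := 2 - `|x + y|.
have d_lt : d < 2 * (C' * e `^ q) by rewrite /d; lra.
have d_e : d < e / 8.
  apply: lt_le_trans d_lt _.
  have : C' * e `^ q <= 1 / 16 * e by apply: ler_pM => //; lra.
  lra.
have xd : 1 - d <= `|x| by rewrite /d; have := ler_normD x y; lra.
have yd : 1 - d <= `|y| by rewrite /d; have := ler_normD x y; lra.
have x0 : 0 < `|x| by lra.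
have y0 : 0 < `|y| by lra.
have [] := normalize_dist x0 x1 xd; have [] := normalize_dist y0 y1 yd.
set u := _ *: x; set v := _ *: y => v1 vy u1 ux.
have huv := uc _ _ u1 v1.
have h1 : `|x + y| <= `|u + v| + 2 * d.
  have := lerB_dist (x + y) (u + v); rewrite opprD addrACA.
  have := ler_normD (x - u) (y - v); rewrite (distrC x) (distrC y); lra.
have h2 : `|x - y| <= `|u - v| + 2 * d.
  have := lerB_dist (x - y) (u - v); rewrite opprD addrACA -opprD.
  have := ler_normB (x - u) (y - v); rewrite (distrC x) (distrC y); lra.
have h3 : C * (2^-1 `^ q * e `^ q) <= C * `|u - v| `^ q.
  rewrite ler_pM2l// -powRM; [|lra|lra].
  by apply: ge0_ler_powR; rewrite ?nnegrE; lra.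
have h4 : 6 * C' * e `^ q <= C * 2^-1 `^ q * e `^ q by rewrite ler_pM2r.
by move: h1; rewrite (_ : `|x + y| = 2 - d); [lra|rewrite /d; lra].
Qed.

(* Here [g] is the factor map near an edge of duration [tau], as a function of the
   time since its start and of the [n] unused coordinates. *)
Lemma descent (R : realType) (Y : normedModType R) (eta p B L M kappa theta : R) :
  0 < eta <= 1 -> 1 <= p -> 0 <= L -> 0 < M -> 0 <= kappa <= 1 -> 0 <= theta ->
  0 <= B -> theta * B * M <= eta ->
  (forall (a b : Y) (rho : R), 0 <= rho -> `|a| <= rho -> `|b| <= rho ->
     theta * rho <= `|a - b| -> `|a + b| <= 2 * rho * (1 - kappa)) ->
  forall (n : nat) (tau K : R) (g : R -> (nat -> R) -> Y),
  0 < tau -> 0 <= K -> L * (K + n%:R * eta `^ p) `^ p^-1 <= B ->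
  (forall s t x y, `|g s x - g t y|
     <= L * (K * `|s - t| `^ p + \sum_(j < n) `|x j - y j| `^ p) `^ p^-1) ->
  (forall s t x y, 0 <= s <= tau -> 0 <= t <= tau ->
     avg n (fun i => `|Phi eta n tau s 0 x i - Phi eta n tau t 0 y i|)
     <= M * `|g s x - g t y|) ->
  `|g tau (fun=> 0) - g 0 (fun=> 0)| <= B * tau * (1 - kappa) ^+ n.
Proof.
move=> /andP[e0 e1] p1 L0 M0 /andP[k0 k1] th0 B0 thB uc.
have e01 : 0 <= eta <= 1 by rewrite ltW.
have p0 : 0 < p by lra.
elim=> [|n IH] tau K g tau0 K0 KB lip low.
  rewrite expr0 mulr1; apply: le_trans (lip _ _ _ _) _.
  rewrite big_ord0 addr0 subr0 gtr0_norm// powRM ?powR_ge0//.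
  rewrite -powRrM mulfV ?gt_eqF// powRr1; last exact: ltW.
  rewrite mulrA ler_pM2r//.
  by move: KB; rewrite mul0r addr0.
have tau4 : 0 < tau / 4 by rewrite divr_gt0.
pose zero : nat -> R := fun=> 0.
(* Images of the vertices along branch [sg]; the branches differ only at the tip [c = 2]. *)
pose Q sg c := g (c%:R * (tau / 4)) (child eta tau sg c 0 zero).
pose r := B * (tau / 4) * (1 - kappa) ^+ n.
have ep0 : 0 <= eta `^ p by rewrite powR_ge0.
(* The induction hypothesis for a child edge: its slope [eta] in a new coordinate adds [eta ^ p] to
   [K], which the term [n * eta ^ p] has reserved. *)
have stepQ sg c : `|sg| = 1 -> (c < 4)%N -> `|Q sg c.+1 - Q sg c| <= r.
  move=> sg1 c4.
  have := IH (tau / 4) (K + eta `^ p)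
    (fun s x => g (c%:R * (tau / 4) + s) (child eta tau sg c s x)) tau4.
  rewrite addr_ge0//.
  have -> : child eta tau sg c (tau / 4) (fun=> 0) = child eta tau sg c.+1 0 zero.
    apply/funext => -[|j] //=; rewrite /child.
    by rewrite (_ : _ + tau / 4 = c.+1%:R * (tau / 4) + 0)// -natr1; ring.
  rewrite (_ : c%:R * (tau / 4) + tau / 4 = c.+1%:R * (tau / 4)); last first.
    by rewrite -natr1; ring.
  rewrite addr0; apply=> //.
  - by move: KB; rewrite -natr1 mulrDl mul1r [X in K + X]addrC addrA.
  - move=> s t x y; apply: le_trans (lip _ _ _ _) _.
    rewrite ler_wpM2l//; apply: ge0_ler_powR; rewrite ?nnegrE.
    + by rewrite invr_ge0 ltW.
    + by rewrite addr_ge0 ?sumr_ge0 ?mulr_ge0 ?powR_ge0// => *; rewrite powR_ge0.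
    + by rewrite addr_ge0 ?sumr_ge0 ?mulr_ge0 ?addr_ge0// => *; rewrite powR_ge0.
    rewrite big_ord_recl /= addrA; apply: lerD; last by [].
    rewrite (_ : c%:R * (tau / 4) + s - (c%:R * (tau / 4) + t) = s - t); last by ring.
    rewrite mulrDl lerD2l -powRM//; last exact: ltW.
    apply: ge0_ler_powR; rewrite ?nnegrE ?mulr_ge0//; [exact: ltW|exact: ltW|].
    rewrite -mulrBr normrM sg1 mul1r -mulrBr normrM gtr0_norm// ler_pM2l//.
    apply: le_trans (tent_lipschitz _ _ _) _.
    by rewrite (_ : c%:R * (tau / 4) + s - (c%:R * (tau / 4) + t) = s - t)//; ring.
  - move=> s t x y hs ht.
    pose F i := Phi eta n (tau / 4) s 0 x i - Phi eta n (tau / 4) t 0 y i.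
    rewrite -(@avg_norm_weighted _ n (eta * child_slope sg c) F); last first.
      rewrite normrM gtr0_norm//; apply: mulr_ile1 => //; first exact: ltW.
      rewrite /child_slope.
      by case: ifP => _; [|case: ifP => _]; rewrite ?normrN ?sg1 ?normr0.
    have hc r' : 0 <= r' <= tau / 4 -> 0 <= c%:R * (tau / 4) + r' <= tau.
      by case: c c4 {F} => [|[|[|[|//]]]] _ /=; lra.
    apply: le_trans (low _ _ _ _ (hc s hs) (hc t ht)).
    apply: le_avg => i; rewrite !Phi_child ?e0// le_eqVlt; apply/orP; left.
    by apply/eqP; congr (`|_|); rewrite /F; ring.
have Q0 sg : Q sg 0%N = g 0 zero.
  rewrite /Q mul0r; congr (g _ _); apply/funext => -[|j] //=.
  rewrite /child tent_child//; first by rewrite !mulr0.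
  by rewrite lexx/= ltW.
have Q4 sg : Q sg 4%N = g tau zero.
  rewrite /Q (_ : 4%:R * (tau / 4) = tau); last by field.
  congr (g _ _); apply/funext => -[|j] //=.
  rewrite /child (_ : 4%:R * (tau / 4) + 0 = 3%:R * (tau / 4) + tau / 4); last by ring.
  rewrite tent_child//; first by rewrite !mulr0.
  by rewrite lexx/= ltW.
(* At the tips, at heights [eta * tau / 4] and its negative, the values of [Phi] differ by
   [eta * tau / 2] for every choice of signs. *)
have Q2 : eta * tau / 2 <= M * `|Q 1 2%N - Q (-1) 2%N|.
  apply: le_trans (low _ _ _ _ _ _); [|lra|lra].
  rewrite -(avg_cst n.+1 (eta * tau / 2)); apply: le_avg => i.
  rewrite -[X in Phi _ _ _ X]addr0 !Phi_child ?e0 ?normrN ?normr1 ?lexx ?(ltW tau4)//.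
  rewrite /Phi !add0r Psi_eq0//.
    rewrite !mulr0 !addr0 !mulr1.
    rewrite (_ : _ - _ = (-1) ^+ odd i * (eta * tau / 2)); last by field.
    by rewrite normrM normr_sign mul1r ler_norm.
  by rewrite /radius (_ : Num.min _ _ = 0) ?mulr0//; apply/min_idPl; rewrite subr0 ltW.
have r0 : 0 <= r by rewrite /r !mulr_ge0 ?exprn_ge0// ?(ltW tau4)//; lra.
have half sg c : `|sg| = 1 -> (c < 3)%N -> `|Q sg c.+2 - Q sg c| <= 2 * r.
  move=> sg1 c3.
  rewrite (_ : Q sg c.+2 - Q sg c = (Q sg c.+2 - Q sg c.+1) + (Q sg c.+1 - Q sg c)).
    apply: le_trans (ler_normD _ _) _.
    have := stepQ sg c.+1 sg1 c3; have := stepQ sg c sg1 (ltnW c3); lra.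
  by rewrite addrA subrK.
have N1 : `|-1 : R| = 1 by rewrite normrN normr1.
have k1n : (1 - kappa) ^+ n <= 1 by rewrite exprn_ile1//; lra.
have mid : theta * (2 * r) <= `|Q 1 2%N - Q (-1) 2%N|.
  rewrite -(ler_pM2l M0); apply: le_trans Q2.
  have h : theta * B * M * (tau / 2) <= eta * (tau / 2).
    by rewrite ler_wpM2r// divr_ge0// ltW.
  have h' : theta * B * M * (tau / 2) * (1 - kappa) ^+ n <= theta * B * M * (tau / 2).
    by rewrite -[leRHS]mulr1 ler_wpM2l// !mulr_ge0// ?divr_ge0// ltW.
  rewrite /r; lra.
have hA := uc (Q 1 2%N - g 0 zero) (Q (-1) 2%N - g 0 zero) (2 * r).
have hB := uc (g tau zero - Q 1 2%N) (g tau zero - Q (-1) 2%N) (2 * r).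
(* The displacement is the mean of the paths through the two tips. First and second halves each form
   a pair of vectors of norm at most [2 * r] whose difference is that of the tips, so convexity
   applies to both pairs. *)
have -> : g tau (fun=> 0) - g 0 (fun=> 0) =
  2^-1 *: ((Q 1 2%N - g 0 zero + (Q (-1) 2%N - g 0 zero))
   + (g tau zero - Q 1 2%N + (g tau zero - Q (-1) 2%N))).
  have mv (u o e : Y) : u - o + (e - u) = e - o by rewrite addrC addrA subrK.
  rewrite addrACA !mv -mulr2n -(scaler_nat 2 (_ - _ : Y)) scalerA mulVf ?scale1r//.
rewrite normrZ ger0_norm ?invr_ge0//.
have := half 1 0%N (normr1 _) isT; have := half 1 2%N (normr1 _) isT.
have := half (-1) 0%N N1 isT; have := half (-1) 2%N N1 isT.
rewrite !Q0 !Q4 => h1 h2 h3 h4.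
have r20 : 0 <= 2 * r by rewrite mulr_ge0.
have {}hA := hA r20 h4 h2; have {}hB := hB r20 h3 h1.
have mA : theta * (2 * r) <= `|Q 1 2%N - g 0 zero - (Q (-1) 2%N - g 0 zero)|.
  by rewrite opprB addrA subrK.
have mB : theta * (2 * r) <= `|g tau zero - Q 1 2%N - (g tau zero - Q (-1) 2%N)|.
  by rewrite opprB addrC addrA subrK distrC.
have {}hA := hA mA; have {}hB := hB mB.
set a := (_ + (Q (-1) 2%N - _)) in hA *; set b := (_ + (g tau zero - _)) in hB *.
have := ler_normD a b; rewrite exprSr /r in hA hB *; lra.
Qed.

(** * Sequence spaces and the direct sum of the diamond maps *)

Lemma series_powR_nd (R : realType) (p : R) (u : nat -> R) :
  nondecreasing_seq (series (fun k => `|u k| `^ p)).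
Proof. by apply: nondecreasing_series => k _ _; exact: powR_ge0. Qed.

Lemma in_lp_bounded (R : realType) (p B : R) (u : nat -> R) :
  (forall n, \sum_(k < n) `|u k| `^ p <= B) ->
  in_lp p u /\ limn (series (fun k => `|u k| `^ p)) <= B.
Proof.
move=> uB; have ub n : series (fun k => `|u k| `^ p) n <= B.
  by rewrite /series /= big_mkord.
have cu : cvgn (series (fun k => `|u k| `^ p)).
  apply: nondecreasing_is_cvgn; first exact: series_powR_nd.
  by exists B => _ [n _ <-].
by split=> //; apply: limr_le => //; near=> n; exact: ub.
Unshelve. all: by end_near. Qed.

Lemma sum_le_lim (R : realType) (p : R) (u : nat -> R) (n : nat) : in_lp p u ->
  \sum_(k < n) `|u k| `^ p <= limn (series (fun k => `|u k| `^ p)).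
Proof.
move=> cu; have := nondecreasing_cvgn_le (@series_powR_nd _ p u) cu n.
by rewrite /series /= big_mkord.
Qed.

Lemma lim_series_powR_ge0 (R : realType) (p : R) (u : nat -> R) : in_lp p u ->
  0 <= limn (series (fun k => `|u k| `^ p)).
Proof. by move=> /(@sum_le_lim _ p u 0); rewrite big_ord0. Qed.

Lemma lp_norm_ge0 (R : realType) (p : R) (u : nat -> R) : 0 <= lp_norm p u.
Proof. exact: powR_ge0. Qed.

Lemma le_lp_norm (R : realType) (p : R) (u : nat -> R) (j : nat) : 0 < p ->
  in_lp p u -> `|u j| <= lp_norm p u.
Proof.
move=> p0 cu; have := sum_le_lim j.+1 cu; rewrite big_ord_recr /= => h.
have uj : `|u j| = (`|u j| `^ p) `^ p^-1.
  by rewrite -powRrM mulfV ?gt_eqF// powRr1.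
rewrite uj; apply: ge0_ler_powR; rewrite ?nnegrE ?powR_ge0//.
- by rewrite invr_ge0 ltW.
- exact: lim_series_powR_ge0.
- by apply: le_trans h; rewrite lerDr sumr_ge0// => i _; exact: powR_ge0.
Qed.

Lemma powR_normB (R : realType) (p a b : R) : 0 <= p ->
  `|a - b| `^ p <= 2 `^ p * (`|a| `^ p + `|b| `^ p).
Proof.
move=> p0; wlog ab : a b / `|a| <= `|b|.
  move=> H; have [/H//|/ltW/H] := leP `|a| `|b|.
  by rewrite distrC [X in _ <= _ * X]addrC.
apply: (@le_trans _ _ ((2 * `|b|) `^ p)).
  apply: ge0_ler_powR; rewrite ?nnegrE ?mulr_ge0//.
  by apply: le_trans (ler_normB _ _) _; lra.
by rewrite powRM// ler_wpM2l ?powR_ge0// lerDr powR_ge0.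
Qed.

Lemma in_lp_sub (R : realType) (p : R) (x y : nat -> R) : 0 <= p ->
  in_lp p x -> in_lp p y -> in_lp p (Defs.seq_sub x y).
Proof.
move=> p0 cx cy.
pose S (u : nat -> R) := limn (series (fun k => `|u k| `^ p)).
have [] // := @in_lp_bounded _ p (2 `^ p * (S x + S y)) (Defs.seq_sub x y).
move=> n.
apply: (@le_trans _ _ (2 `^ p * (\sum_(k < n) `|x k| `^ p + \sum_(k < n) `|y k| `^ p))).
  by rewrite -big_split /= mulr_sumr; apply: ler_sum => k _; exact: powR_normB.
by rewrite ler_wpM2l ?powR_ge0// lerD// sum_le_lim.
Qed.

Lemma lp_norm_finite (R : realType) (p : R) (u : nat -> R) (n : nat) : 0 < p ->
  (forall k, (n <= k)%N -> u k = 0) ->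
  in_lp p u /\ lp_norm p u = (\sum_(k < n) `|u k| `^ p) `^ p^-1.
Proof.
move=> p0 u0.
have ub m : \sum_(k < m) `|u k| `^ p <= \sum_(k < n) `|u k| `^ p.
  have sum0 a b : (n <= a)%N -> \sum_(a <= k < b) `|u k| `^ p = 0.
    move=> na; rewrite big_nat big1// => k /andP[ak _].
    by rewrite u0 ?(leq_trans na)// normr0 powR0// gt_eqF.
  rewrite -!(big_mkord xpredT (fun k => `|u k| `^ p)).
  case: (leqP m n) => [mn|/ltnW nm].
    rewrite [leRHS](big_cat_nat (n := m))//= lerDl sumr_ge0// => k _; exact: powR_ge0.
  by rewrite [leLHS](big_cat_nat (n := n))//= (sum0 n m)// addr0.
have [cu lu] := in_lp_bounded ub.
split=> //; rewrite /lp_norm; congr (_ `^ _); apply/eqP.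
by rewrite eq_le lu sum_le_lim.
Qed.

Lemma lp1_bounded (R : realType) (B : R) (u : nat -> R) :
  (forall n, \sum_(k < n) `|u k| <= B) -> in_lp 1 u /\ lp_norm 1 u <= B.
Proof.
move=> uB; have [|cu lu] := @in_lp_bounded _ 1 B u.
  by move=> n; under eq_bigr do rewrite powRr1//; exact: uB.
split=> //; rewrite /lp_norm invr1 powRr1//; exact: lim_series_powR_ge0.
Qed.

Lemma sum_le_lp1 (R : realType) (u : nat -> R) (n : nat) : in_lp 1 u ->
  \sum_(k < n) `|u k| <= lp_norm 1 u.
Proof.
move=> cu; rewrite /lp_norm invr1 powRr1 ?lim_series_powR_ge0//.
by apply: le_trans (sum_le_lim n cu); under [leRHS]eq_bigr do rewrite powRr1//.
Qed.

(** Its positive powers must outgrow every fixed power of [2 ^ n], the loss due to the weights. *)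
Definition depth (n : nat) : nat := (2 ^ (n ^ 2))%N.

(** Every [m] gets a block of coordinates, with weight zero unless [m] is some [depth n]; as
    [n <= depth n], the finite range misses nothing. *)
Definition weight {R : realType} (m : nat) : R :=
  \sum_(n < m.+1) (m == depth n)%:R / 2 ^+ n.

Lemma weight_ge0 (R : realType) (m : nat) : 0 <= weight m :> R.
Proof. by apply: sumr_ge0 => n _; rewrite divr_ge0// exprn_ge0. Qed.

Lemma weight_pow (R : realType) (n : nat) : (2 ^+ n)^-1 <= weight (depth n) :> R.
Proof.
have nm : (n < (depth n).+1)%N.
  rewrite ltnS; apply: (@leq_trans (n ^ 2)); last exact/ltnW/ltn_expl.
  by case: n => // n; rewrite -mulnn leq_pmull.
rewrite /weight (bigD1 (Ordinal nm)) //= eqxx mul1r lerDl.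
by apply: sumr_ge0 => k _; rewrite divr_ge0// exprn_ge0.
Qed.

Lemma sum_half_le2 (R : realType) (M : nat) : \sum_(n < M) (2 ^+ n)^-1 <= 2 :> R.
Proof.
suff -> : \sum_(n < M) (2 ^+ n)^-1 = 2 - 2 / 2 ^+ M :> R.
  by rewrite lerBlDr lerDl divr_ge0// exprn_ge0.
elim: M => [|M IH]; first by rewrite big_ord0 expr0 divr1 subrr.
by rewrite big_ord_recr /= IH exprS; field; rewrite expf_neq0.
Qed.

Lemma sum_weight_le2 (R : realType) (M : nat) : \sum_(m < M) weight m <= 2 :> R.
Proof.
apply: le_trans (sum_half_le2 R M).
apply: (@le_trans _ _ (\sum_(m < M) \sum_(n < M)
    ((m : nat) == depth n)%:R / 2 ^+ n)).
  apply: ler_sum => m _; rewrite /weight (big_ord_widen M (fun n =>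
    ((m : nat) == depth n)%:R / 2 ^+ n))//.
  rewrite big_mkcond; apply: ler_sum => n _.
  by case: ifP => // _; rewrite divr_ge0// exprn_ge0.
rewrite exchange_big /=; apply: ler_sum => n _.
rewrite -mulr_suml -[leRHS]mul1r ler_wpM2r ?invr_ge0 ?exprn_ge0//.
have [kM|Mk] := ltnP (depth n) M.
  rewrite (bigD1 (Ordinal kM))//= eqxx big1 ?addr0// => m.
  by rewrite -val_eqE /= => /negPf ->.
rewrite big1// => m _; case: eqP => // mk.
by have := ltn_ord m; rewrite mk ltnNge Mk.
Qed.

Lemma sum_dyadic (R : realType) (M : nat) (a : nat -> R) :
  \sum_(k < (2 ^ M).-1) a k = \sum_(m < M) \sum_(i < 2 ^ m) a ((2 ^ m).-1 + i)%N.
Proof.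
elim: M => [|M IH]; first by rewrite !big_ord0.
rewrite big_ord_recr /= -IH.
rewrite (_ : (2 ^ M.+1).-1 = ((2 ^ M).-1 + 2 ^ M)%N); last first.
  by rewrite expnS mul2n -addnn -subn1 -subn1 addnBAC// expn_gt0.
by rewrite big_split_ord.
Qed.

Definition steepness {R : realType} (p : R) (m : nat) : R := m%:R `^ (- p^-1).

Lemma steepness01 (R : realType) (p : R) (m : nat) : 0 < p ->
  0 <= steepness p m <= 1.
Proof.
move=> p0; rewrite powR_ge0 /=; case: m => [|m].
  by rewrite /steepness powR0// oppr_eq0 invr_eq0 gt_eqF.
rewrite /steepness -[leRHS](powRr0 m.+1%:R); apply: ler_powR.
  by rewrite ler1n.
by rewrite oppr_le0 invr_ge0 ltW.
Qed.

(* The indices [k] with [2 ^ m <= k + 1 < 2 ^ (m + 1)] carry the copy of depth [m]. *)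
Definition diamond_map {R : realType} (p : R) (x : nat -> R) (k : nat) : R :=
  let m := trunc_log 2 k.+1 in
  weight m / 2 ^+ m
  * Phi (steepness p m) m 1 (x 0%N) 0 (fun j => x j.+1) (k.+1 - 2 ^ m).

Lemma diamond_map_block (R : realType) (p : R) (x : nat -> R) (m i : nat) :
  (i < 2 ^ m)%N ->
  diamond_map p x ((2 ^ m).-1 + i)%N
  = weight m / 2 ^+ m * Phi (steepness p m) m 1 (x 0%N) 0 (fun j => x j.+1) i.
Proof.
move=> im; rewrite /diamond_map.
have -> : ((2 ^ m).-1 + i).+1 = (2 ^ m + i)%N by rewrite -addSn prednK// expn_gt0.
have -> : trunc_log 2 (2 ^ m + i) = m.
  by apply: trunc_log_eq => //; rewrite leq_addr expnS mul2n -addnn ltn_add2l.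
by rewrite addKn.
Qed.

(** Division by [2 ^+ m] in [diamond_map] turns the l_1 sum over a block into an average over
    signs. *)
Lemma sum_block (R : realType) (p : R) (x y : nat -> R) (m : nat) :
  \sum_(i < 2 ^ m) `|diamond_map p x ((2 ^ m).-1 + i)%N
                     - diamond_map p y ((2 ^ m).-1 + i)%N|
  = weight m * avg m (fun i =>
      `|Phi (steepness p m) m 1 (x 0%N) 0 (fun j => x j.+1) i
        - Phi (steepness p m) m 1 (y 0%N) 0 (fun j => y j.+1) i|).
Proof.
rewrite /avg mulrA mulrAC mulr_sumr; apply: eq_bigr => i _.
rewrite !diamond_map_block// -mulrBr normrM ger0_norm//.
by rewrite divr_ge0 ?weight_ge0// exprn_ge0.
Qed.

Lemma diamond_map_sum_lipschitz (R : realType) (p D : R) (x y : nat -> R) (n : nat) :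
  0 < p -> (forall j, `|x j - y j| <= D) ->
  \sum_(k < n) `|diamond_map p x k - diamond_map p y k| <= 160 * D.
Proof.
move=> p0 xy; have D0 : 0 <= D by apply: le_trans (xy 0%N).
pose a k := `|diamond_map p x k - diamond_map p y k|.
apply: (@le_trans _ _ (\sum_(k < (2 ^ n).-1) a k)).
  have nn : (n <= (2 ^ n).-1)%N by rewrite -ltnS (prednK (expn_gt0 2 n)) (ltn_expl n).
  rewrite (big_ord_widen _ a nn) big_mkcond; apply: ler_sum => k _.
  by case: ifP => // _; rewrite normr_ge0.
rewrite sum_dyadic; under eq_bigr do rewrite sum_block.
apply: (@le_trans _ _ (\sum_(m < n) weight m * (80 * D))).
  apply: ler_sum => m _; rewrite ler_wpM2l ?weight_ge0//.
  apply: Phi_lipschitz => //; first exact: steepness01.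
  by rewrite subrr normr0 mulr_ge0.
rewrite -mulr_suml (_ : 160 * D = 2 * (80 * D)); last by lra.
by rewrite ler_wpM2r ?sum_weight_le2// mulr_ge0.
Qed.

Lemma diamond_map_lipschitz (R : realType) (p : R) : 1 <= p ->
  lipschitz_lp_lp p 1 (diamond_map p).
Proof.
move=> p1; have p0 : 0 < p by lra.
(* Since the map sends 0 to 0, its values lie in l_1 by the estimate for differences. *)
have f0 k : diamond_map p (fun=> 0) k = 0.
  rewrite /diamond_map /Phi add0r Psi_eq0 ?mulr0 ?steepness01//.
  by rewrite /radius (_ : Num.min _ _ = 0) ?mulr0//; apply/min_idPl; lra.
have in0 : in_lp p (fun=> 0 : R).
  by have [] := @lp_norm_finite _ p (fun=> 0) 0 p0 (fun _ _ => erefl).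
have main x y : in_lp p x -> in_lp p y ->
    in_lp 1 (Defs.seq_sub (diamond_map p x) (diamond_map p y)) /\
    lp_norm 1 (Defs.seq_sub (diamond_map p x) (diamond_map p y))
      <= 160 * lp_norm p (Defs.seq_sub x y).
  move=> cx cy; apply: lp1_bounded => n.
  apply: diamond_map_sum_lipschitz => // j.
  exact: (@le_lp_norm _ p (Defs.seq_sub x y) j p0 (in_lp_sub (ltW p0) cx cy)).
split; last by exists 160 => x y cx cy; exact: (proj2 (main x y cx cy)).
move=> x cx; have [+ _] := main x (fun=> 0) cx in0.
rewrite (_ : Defs.seq_sub _ _ = diamond_map p x)//.
by apply/funext => k; rewrite /Defs.seq_sub f0 subr0.
Qed.

Lemma Psi_ext (R : realType) (eta : R) (n : nat) (tau t d : R) (x y : nat -> R)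
    (i : nat) :
  (forall j, (j < n)%N -> x j = y j) -> Psi eta n tau t d x i = Psi eta n tau t d y i.
Proof.
elim: n tau t d x y i => [//|n IH] tau t d x y i xy /=.
rewrite (xy 0%N)//; congr (_ + _ * _); apply: IH => j jn; exact: xy.
Qed.

(** * Absence of factorizations *)

Lemma expr_1B_bound (R : realType) (k : R) (m : nat) : 0 <= k <= 1 ->
  (1 - k) ^+ m * (1 + m%:R * k) <= 1.
Proof.
move=> /andP[k0 k1]; elim: m => [|m IH]; first by rewrite expr0 mul0r addr0 mulr1.
apply: le_trans IH; rewrite exprSr -mulrA ler_wpM2l ?exprn_ge0//; first lra.
have : 0 <= m.+1%:R * (k * k) by rewrite !mulr_ge0.
rewrite -natr1; lra.
Qed.

Definition embed {R : realType} (m : nat) (s : R) (z : nat -> R) (k : nat) : R :=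
  if k is j.+1 then (if (j < m)%N then z j else 0) else s.

Lemma embed_lp (R : realType) (p : R) (m : nat) (s t : R) (z y : nat -> R) : 0 < p ->
  in_lp p (embed m s z) /\
  lp_norm p (Defs.seq_sub (embed m s z) (embed m t y))
  = (1 * `|s - t| `^ p + \sum_(j < m) `|z j - y j| `^ p) `^ p^-1.
Proof.
move=> p0.
have out (r : R) v k : (m.+1 <= k)%N -> embed m r v k = 0.
  by case: k => // k; rewrite ltnS /= ltnNge => ->.
split; first by have [] := lp_norm_finite p0 (out s z).
have [|_ ->] := @lp_norm_finite _ p (Defs.seq_sub (embed m s z) (embed m t y)) m.+1 p0.
  by move=> k mk; rewrite /Defs.seq_sub !out// subrr.
rewrite mul1r; congr (_ `^ _); rewrite big_ord_recl; congr (_ + _).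
by apply: eq_bigr => j _; rewrite /Defs.seq_sub /= ltn_ord.
Qed.

(** Only the block of depth [m] is kept; its weight is at least [2 ^- n]. *)
Lemma avg_le_norm (R : realType) (p s t : R) (z y : nat -> R) (n m : nat) :
  m = depth n ->
  in_lp 1 (Defs.seq_sub (diamond_map p (embed m s z)) (diamond_map p (embed m t y))) ->
  avg m (fun i => `|Phi (steepness p m) m 1 s 0 z i - Phi (steepness p m) m 1 t 0 y i|)
  <= 2 ^+ n * lp_norm 1
    (Defs.seq_sub (diamond_map p (embed m s z)) (diamond_map p (embed m t y))).
Proof.
move=> mE cu.
set A := avg _ _.
have A0 : 0 <= A by rewrite -(avg_cst m 0); apply: le_avg => i.
have two : 0 < 2 ^+ n :> R by rewrite exprn_gt0.
rewrite -ler_pdivrMl//; apply: le_trans (sum_le_lp1 (2 ^ m.+1).-1 cu).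
rewrite (sum_dyadic m.+1 (fun k => `|_ k|)) big_ord_recr /= ler_wpDl//.
  by apply: sumr_ge0 => i _; exact: sumr_ge0.
rewrite sum_block; apply: le_trans (ler_wpM2r A0 (weight_pow R n)) _; rewrite -mE.
rewrite ler_wpM2l ?weight_ge0// le_eqVlt; apply/orP; left; apply/eqP.
apply: eq_avg => i; rewrite /Phi /=.
by congr (`|_ + _ - (_ + _)|); apply: Psi_ext => j jm; rewrite jm.
Qed.

(** [descent] is applied on each block with [T = 2 * L * M'] and [theta = eta / (T * 2 ^+ n)], so
    that [theta * B * M = eta]; the decay it gives is compared with the unit displacement of [Phi]
    along the axis. *)
Lemma factorization_bound (R : realType) (p q : R) (Y : normedModType R)
    (g : (nat -> R) -> Y) (h : Y -> (nat -> R)) :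
  1 <= p -> 1 <= q -> unif_convex_power_type (Y := Y) q ->
  lipschitz_lp_Y p g -> lipschitz_Y_lp (g @` lp_set p) 1 h ->
  (forall x, lp_set p x -> diamond_map p x = h (g x)) ->
  exists C T : R, [/\ 0 < C, 1 <= T & forall n : nat,
    1 + (depth n)%:R * (C * (steepness p (depth n) / (T * 2 ^+ n)) `^ q)
      <= T * 2 ^+ n].
Proof.
move=> p1 q1 uc [L0 glip] [hlp [M0 hlip]] fhg.
have p0 : 0 < p by lra.
have [C [C0 C1 ucb]] := unif_convex_ball q1 uc.
pose L := Num.max 1 L0; pose M' := Num.max 1 M0.
have L1 : 1 <= L by rewrite le_max lexx.
have M1 : 1 <= M' by rewrite le_max lexx.
exists C, (2 * L * M'); split; [exact: C0| |move=> n].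
  by have := ler_pM ler01 ler01 L1 M1; rewrite mul1r; lra.
set m := depth n; set T : R := 2 * L * M'.
have T1 : 1 <= T by have := ler_pM ler01 ler01 L1 M1; rewrite mul1r /T; lra.
have two : 1 <= 2 ^+ n :> R by rewrite exprn_ege1// ler1n.
have T2 : 1 <= T * 2 ^+ n by have := ler_pM ler01 ler01 T1 two; rewrite mul1r.
set eta := steepness p m; set theta := eta / (T * 2 ^+ n).
have m0 : (0 < m)%N by rewrite expn_gt0.
have eta0 : 0 < eta by rewrite powR_gt0// ltr0n.
have eta1 : eta <= 1 by have /andP[] := steepness01 m p0.
have theta0 : 0 <= theta by rewrite divr_ge0 ?ltW//; lra.
have theta1 : theta <= 1 by rewrite ler_pdivrMr; lra.
set kappa := C * theta `^ q.
have kappa0 : 0 <= kappa by rewrite mulr_ge0 ?powR_ge0// ltW.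
have kappa1 : kappa <= 1.
  apply: mulr_ile1 => //; [exact: ltW|exact: powR_ge0|].
  apply: (@le_trans _ _ (1 `^ q)); last by rewrite powR1.
  apply: ge0_ler_powR; rewrite ?nnegrE//; lra.
(* This is the reason for the exponent in [steepness]: the edges of the last scale have speed at
   most 2. *)
have meta : m%:R * eta `^ p = 1.
  rewrite /eta /steepness -powRrM mulNr mulVf ?gt_eqF// powR_inv1// mulfV//.
  by rewrite pnatr_eq0 -lt0n.
have lipg s t x y : `|g (embed m s x) - g (embed m t y)|
    <= L * (1 * `|s - t| `^ p + \sum_(j < m) `|x j - y j| `^ p) `^ p^-1.
  have [cx <-] := embed_lp m s t x y p0; have [cy _] := embed_lp m t s y x p0.
  apply: le_trans (glip _ _ cx cy) _.
  by rewrite ler_wpM2r ?lp_norm_ge0// le_max lexx orbT.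
have low s t x y : 
    avg m (fun i => `|Phi eta m 1 s 0 x i - Phi eta m 1 t 0 y i|)
    <= (M' * 2 ^+ n) * `|g (embed m s x) - g (embed m t y)|.
  have [cx _] := embed_lp m s t x y p0; have [cy _] := embed_lp m t s y x p0.
  have gx := imageP g (cx : lp_set p _); have gy := imageP g (cy : lp_set p _).
  have := @avg_le_norm _ p s t x y n m erefl.
  rewrite (fhg _ cx) (fhg _ cy) => avg_le; apply: le_trans (avg_le _) _.
    by apply: in_lp_sub; [exact: ler01|exact: hlp|exact: hlp].
  rewrite [M' * _]mulrC -mulrA ler_wpM2l ?exprn_ge0//.
  apply: le_trans (hlip _ _ gx gy) _.
  by rewrite ler_wpM2r// le_max lexx orbT.
have KB : L * (1 + m%:R * eta `^ p) `^ p^-1 <= 2 * L.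
  rewrite meta mulrC ler_wpM2r//; first lra.
  rewrite -[leRHS]powRr1//; apply: ler_powR; first lra.
  by rewrite invf_le1.
have := @descent R Y eta p (2 * L) L (M' * 2 ^+ n) kappa theta _ p1 _ _ _ theta0 _ _ _
  m 1 1 (fun s x => g (embed m s x)) ltr01 ler01 KB lipg (fun s t x y _ _ => low s t x y).
rewrite eta0 eta1 kappa0 kappa1 => desc.
have {}desc : `|g (embed m 1 (fun=> 0)) - g (embed m 0 (fun=> 0))|
    <= 2 * L * (1 - kappa) ^+ m.
  rewrite -[2 * L]mulr1; apply: desc => //; try lra.
  - by rewrite mulr_gt0 ?exprn_gt0//; lra.
  - rewrite /theta (_ : _ * (M' * _) = eta) // /T; field.
    by apply/and3P; split; rewrite ?expf_neq0// gt_eqF//; lra.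
  - by move=> a b rho rho0 ha hb; apply: ucb => //; rewrite theta0.
have top : 1 <= M' * 2 ^+ n * `|g (embed m 1 (fun=> 0)) - g (embed m 0 (fun=> 0))|.
  apply: le_trans (low _ _ _ _); rewrite -{1}(avg_cst m 1); apply: le_avg => i.
  rewrite /Phi !Psi_eq0 ?addr0 ?subr0 ?normr1//; rewrite ?(ltW eta0) ?eta1//.
    by rewrite /radius (_ : Num.min _ _ = 0) ?mulr0//; apply/min_idPl; lra.
  by rewrite /radius subrr (_ : Num.min _ _ = 0) ?mulr0//; apply/min_idPr.
have {top desc} main : 1 <= T * 2 ^+ n * (1 - kappa) ^+ m.
  apply: le_trans top _.
  rewrite (_ : T * _ * _ = M' * 2 ^+ n * (2 * L * (1 - kappa) ^+ m)).
    by rewrite ler_wpM2l// mulr_ge0 ?exprn_ge0//; lra.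
  by rewrite /T; ring.
have k01 : 0 <= kappa <= 1 by rewrite kappa0.
have mk : 0 <= 1 + m%:R * kappa by rewrite addr_ge0// mulr_ge0.
have := ler_wpM2r mk main; rewrite mul1r => h1; apply: le_trans h1 _.
rewrite -[leLHS]mulrA -[leRHS]mulr1; apply: ler_wpM2l; first lra.
exact: expr_1B_bound.
Qed.

(** With [m = depth n], [m * eta ^ q] is 2 to the power [n ^ 2 * (1 - q / p)], which beats the power
    [q + 1] of [T * 2 ^ n]. *)
Lemma factorization_bound_fails (R : realType) (p q C T : R) :
  0 < p -> 0 <= q -> q < p -> 0 < C -> 1 <= T ->
  exists n : nat, T * 2 ^+ n
    < 1 + (depth n)%:R * (C * (steepness p (depth n) / (T * 2 ^+ n)) `^ q).
Proof.
move=> p0 q0 qp C0 T1.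
have T0 : 0 < T by lra.
have r0 : 0 < 1 - q / p by rewrite subr_gt0 ltr_pdivrMr// mul1r.
(* The first entry leaves a factor [2 ^ n * 2 ^ n] after paying for [2 ^ (n * q)]; the second lets
   one [2 ^ n] absorb the constants. *)
pose b := Num.max ((q + 2) / (1 - q / p)) (T `^ q * T / C).
have [n nb] : exists n : nat, b < n%:R.
  exists (Num.bound b); apply: archi_boundP; rewrite le_max; apply/orP; right.
  by rewrite divr_ge0 ?mulr_ge0 ?powR_ge0// ltW.
exists n; set m := depth n.
have n1 : q + 2 <= n%:R * (1 - q / p).
  by rewrite -ler_pdivrMr//; apply: le_trans (ltW nb); rewrite /b le_max lexx.
have n2 : T `^ q * T <= C * 2 ^+ n.
  rewrite -ler_pdivrMl// [leLHS]mulrC; apply: (@le_trans _ _ n%:R).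
    by apply: le_trans (ltW nb); rewrite /b le_max lexx orbT.
  by rewrite -natrX ler_nat; apply/ltnW/ltn_expl.
have two : 0 < 2 ^+ n :> R by rewrite exprn_gt0.
have Tq : 0 < T `^ q by rewrite powR_gt0.
have mE : m%:R = 2 `^ (n%:R * n%:R) :> R.
  by rewrite -natrM powR_mulrn// /m /depth natrX -mulnn.
suff : 2 ^+ n * 2 ^+ n * T `^ (- q) <= m%:R * (steepness p m / (T * 2 ^+ n)) `^ q.
  move=> h.
  have h1 : C * (2 ^+ n * 2 ^+ n * T `^ (- q))
      <= m%:R * (C * (steepness p m / (T * 2 ^+ n)) `^ q).
    by rewrite [leRHS]mulrCA ler_pM2l.
  have h2 : T * 2 ^+ n <= C * (2 ^+ n * 2 ^+ n * T `^ (- q)).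
    rewrite powRN (_ : C * _ = C * 2 ^+ n / T `^ q * 2 ^+ n); last by ring.
    by rewrite ler_pM2r// ler_pdivlMr// mulrC.
  lra.
have two' : 2 ^+ n = 2 `^ n%:R :> R by rewrite powR_mulrn.
have -> : (steepness p m / (T * 2 ^+ n)) `^ q
    = 2 `^ (n%:R * n%:R * (- p^-1 * q)) * T `^ (- q) * 2 `^ (- (n%:R * q)).
  have i0 : 0 <= (T * 2 ^+ n)^-1 by rewrite invr_ge0 mulr_ge0// ltW.
  rewrite powRM ?powR_ge0// /steepness mE -!powRrM -[RHS]mulrA; congr (_ `^ _ * _).
  rewrite -powR_inv1; last by rewrite mulr_ge0// ltW.
  rewrite -powRrM mulN1r powRM; [|exact: ltW|exact: ltW].
  by rewrite two' -powRrM mulrN.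
rewrite mE (_ : _ * (_ * _ * _) = T `^ (- q) * (2 `^ (n%:R * n%:R)
  * 2 `^ (n%:R * n%:R * (- p^-1 * q)) * 2 `^ (- (n%:R * q)))); last by ring.
have twoD (u v : R) : 2 `^ u * 2 `^ v = 2 `^ (u + v).
  by rewrite powRD//; apply/implyP.
rewrite [leLHS]mulrC ler_pM2l ?powR_gt0// two' !twoD; apply: ler_powR; first lra.
have h := ler_wpM2l (ler0n R n) n1.
have -> : n%:R * n%:R + n%:R * n%:R * (- p^-1 * q) - n%:R * q
   = n%:R * (n%:R * (1 - q / p)) - n%:R * q by ring.
lra.
Qed.

Lemma diamond_map_not_factor (R : realType) (p q : R) (Y : normedModType R)
    (g : (nat -> R) -> Y) (h : Y -> (nat -> R)) :
  1 <= q -> q < p -> unif_convex_power_type (Y := Y) q ->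
  lipschitz_lp_Y p g -> lipschitz_Y_lp (g @` lp_set p) 1 h ->
  ~ (forall x, lp_set p x -> diamond_map p x = h (g x)).
Proof.
move=> q1 qp uc glip hlip fhg.
have [|C [T [C0 T1 bnd]]] := factorization_bound _ q1 uc glip hlip fhg; first lra.
have [||n] := @factorization_bound_fails _ p q C T _ _ qp C0 T1; [lra|lra|].
by rewrite ltNge bnd.
Qed.

(** By the parallelogram identity, with [a = |x + y|], the claim amounts to [(2 - a) ^ 2 >= 0]. *)
Lemma inner_product_unif_convex (R : realType) (H : normedModType R) (ip : H -> H -> R) :
  is_inner_product ip -> unif_convex_power_type (Y := H) 2.
Proof.
move=> [lin [sym nrm]]; exists (1 / 4); split=> // x y x1 y1.
have add u v w : ip (u + v) w = ip u w + ip v w.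
  by rewrite -[u in LHS]scale1r lin mul1r.
have opp u w : ip (- u) w = - ip u w.
  have z0 : ip 0 w = 0 by have := add 0 0 w; rewrite addr0; lra.
  by apply/eqP; rewrite -subr_eq0 opprK -add addNr z0.
have par : `|x + y| ^+ 2 + `|x - y| ^+ 2 = 4.
  have := nrm x; have := nrm y; rewrite x1 y1 expr1n => yy xx.
  rewrite !nrm !add !(sym x (_ + _)) !(sym _ (_ + _)) !add !opp.
  rewrite !(sym _ (- y)) !opp (sym y x); lra.
rewrite powR_mulrn//.
have s0 : 0 <= `|x - y| ^+ 2 by rewrite exprn_ge0.
have a2 : `|x + y| <= 2 by apply: le_trans (ler_normD _ _) _; rewrite x1 y1; lra.
have a0 : 0 <= `|x + y| by [].
move: par; rewrite expr2; set a := `|x + y| in a2 a0 *; set b := _ ^+ 2 => par.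
have := mulr_ge0 a0 (_ : 0 <= 2 - a); have := sqr_ge0 (2 - a); rewrite expr2; lra.
Qed.

Theorem theorem1p9 (R : realType) (p : R) (hp : 2 < p) :
  exists f : (nat -> R) -> (nat -> R),
    lipschitz_lp_lp p 1 f /\
    (~ exists (H : completeNormedModType R) (ip : H -> H -> R)
           (g : (nat -> R) -> H) (h : H -> (nat -> R)),
         is_inner_product ip /\
         lipschitz_lp_Y p g /\
         lipschitz_Y_lp (g @` lp_set p) 1 h /\
         (forall x, lp_set p x -> f x = h (g x))) /\
    (~ exists (Y : completeNormedModType R) (q : R)
           (g : (nat -> R) -> Y) (h : Y -> (nat -> R)),
         2 <= q /\ q < Num.min 4 p /\
         unif_convex_power_type (Y := Y) q /\
         lipschitz_lp_Y p g /\
         lipschitz_Y_lp (g @` lp_set p) 1 h /\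
         (forall x, lp_set p x -> f x = h (g x))).
Proof.
exists (diamond_map p); split; first by apply: diamond_map_lipschitz; lra.
split.
- move=> [H [ip [g [h [ipH [glip [hlip]]]]]]].
  apply: (@diamond_map_not_factor _ p 2) glip hlip => //; first by rewrite ler1n.
  exact: inner_product_unif_convex ipH.
- move=> [Y [q [g [h [q2 [qp [uc [glip [hlip]]]]]]]]].
  apply: diamond_map_not_factor uc glip hlip; first lra.
  by move: qp; rewrite lt_min => /andP[].
Qed.
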